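(* Let $G=(V,E)$ be a finite connected graph and let $\epsilon\in[0,1]$ with $\epsilon>1/2$. Then \[ P_\epsilon(\text{consensus})\ =\ P_\epsilon(\nu_\epsilon(G)=1)\ \ge\ 2\epsilon-1 . \]
   Context: Opinion dynamics with confidence threshold $\epsilon\in[0,1]$ on a finite connected graph $G=(V,E)$: $(\eta_t)_{t\ge0}$ is the continuous-time pure-jump Markov process with state space $[0,1]^V$, where $\eta_t(x)$ is the opinion of vertex $x$ at time $t$. For each ordered pair $(x,y)$ of adjacent vertices, independently at rate $1$ (at the points of independent Poisson processes), vertex $y$ adopts the opinion of $x$ (i.e. $\eta(y)$ is replaced by $\eta(x)$) if $|\eta(x)-\eta(y)|\le\epsilon$; otherwise nothing happens. $P_\epsilon$ denotes the law of the process with parameter $\epsilon$ started from the random configuration in which $\eta_0(x)$, $x\in V$, are independent and uniformly distributed on $[0,1]$. Since the number of distinct opinions $\operatorname{card}\{\eta_t(x):x\in V\}$ is nonincreasing in $t$, it has a limit; $\nu_\epsilon(G)$ is the random variable $\lim_{t\to\infty}\operatorname{card}\{\eta_t(x):x\in V\}$, the number of opinions coexisting at equilibrium. Consensus is the event that eventually all vertices share the same opinion. *)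

(* Defs.v *)
From HB Require Import structures.
From mathcomp Require Import all_boot all_order all_algebra.
From mathcomp Require Import all_classical all_reals all_analysis.

Set Implicit Arguments.
Unset Strict Implicit.
Unset Printing Implicit Defensive.

Import Order.TTheory GRing.Theory Num.Theory.
Import numFieldNormedType.Exports.

Local Open Scope classical_set_scope.
Local Open Scope ring_scope.

Definition sigma_family d d' (Omega : measurableType d) (T : measurableType d')
    (I : Type) (D : set I) (X : I -> Omega -> T) : set (set Omega) :=
  <<s \bigcup_(i in D) preimage_set_system setT (X i) measurable >>.

Definition mutually_independent d (Omega : measurableType d) (R : realType)
    (P : probability Omega R) (I : finType) (F : I -> set (set Omega)) : Prop :=
  forall (J : {set I}) (A : I -> set Omega), (forall i, i \in J -> F i (A i)) ->
  P (\bigcap_(i in [set` J]) A i) = (\prod_(i in J) P (A i))%E.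

(* [nat] carries the discrete topology, so right-continuity means being
   locally constant on the right. Only times [t >= 0] are constrained. *)
Definition counting_path (R : realType) (n : R -> nat) : Prop :=
  [/\ n 0 = 0%N,
      forall s t : R, 0 <= s -> s <= t -> (n s <= n t)%N &
      forall t : R, 0 <= t -> n r @[r --> t^'+] --> n t].

Record is_poisson_process d (Omega : measurableType d) (R : realType)
    (P : probability Omega R) (rate : R) (N : R -> {RV P >-> nat}) : Prop := {
  poisson_path : forall w, counting_path (fun t => N t w) ;
  poisson_increment_law : forall (s t : R) (k : nat), 0 <= s -> s < t ->
    P [set w | (N t w - N s w)%N = k] = (poisson_pmf (rate * (t - s)) k)%:E ;
  poisson_increment_indep : forall s t : R, 0 <= s -> s < t ->
    forall (A : set Omega) (B : set nat),
    sigma_family [set r | 0 <= r <= s] N A ->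
    P (A `&` [set w | B (N t w - N s w)%N])
      = (P A * P [set w | B (N t w - N s w)%N])%E }.

(* The points of the point process counted by [n]. *)
Definition points (R : realType) (n : R -> nat) : set R :=
  [set t | 0 < t /\ forall s : R, 0 <= s -> s < t -> (n s < n t)%N].

Definition directed_edge (V : finType) (e : rel V) := {a : V * V | e a.1 a.2}.

(* For [a = (x, y)], vertex [y] adopts the opinion of [x]. *)
Definition adopt (R : realType) (V : finType) (eps : R) (a : V * V)
    (xi : V -> R) : V -> R :=
  fun z => if (z == a.2) && (`|xi a.1 - xi a.2| <= eps) then xi a.1 else xi z.

(* One trajectory [xi] driven by the counting paths [n]. Nothing is prescribed
   at a time where two different clocks ring simultaneously; for independent
   Poisson processes this almost surely never happens. *)
Record driven_by (R : realType) (V : finType) (e : rel V) (eps : R)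
    (n : directed_edge e -> R -> nat) (xi : R -> V -> R) : Prop := {
  driven_const : forall s t : R, 0 <= s -> s <= t ->
    (forall b (r : R), s < r -> r <= t -> ~ points (n b) r) ->
    forall z, xi t z = xi s z ;
  driven_jump : forall (s t : R) (a : directed_edge e), 0 <= s -> s < t ->
    points (n a) t ->
    (forall b : directed_edge e, b != a -> ~ points (n b) t) ->
    (forall b (r : R), s < r -> r < t -> ~ points (n b) r) ->
    forall z, xi t z = adopt eps (val a) (xi s) z }.

(* The process started from i.i.d. uniform opinions, through its graphical
   representation: one rate 1 Poisson process for each ordered pair of adjacent
   vertices, all of them independent and independent of the initial opinions.
   The trajectories are constrained for every [w], which makes events
   about all large real times measurable on a possibly incomplete space. *)
Record is_opinion_process d (Omega : measurableType d) (R : realType)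
    (P : probability Omega R) (V : finType) (e : rel V) (eps : R)
    (N : directed_edge e -> R -> {RV P >-> nat})
    (eta : R -> V -> {RV P >-> R}) : Prop := {
  opinion_state : forall (t : R) x w, 0 <= t -> 0 <= eta t x w <= 1 ;
  opinion_initial : forall x (B : set R), measurable B ->
    distribution P (eta 0 x) B = uniform_prob (@ltr01 R) B ;
  opinion_clocks : forall a, is_poisson_process 1 (N a) ;
  opinion_indep : mutually_independent P
    (fun i : V + directed_edge e => match i with
     | inl x => preimage_set_system setT (eta 0 x) measurable
     | inr a => sigma_family [set t | 0 <= t] (N a)
     end) ;
  opinion_dynamics : forall w,
    driven_by eps (fun a t => N a t w) (fun t x => eta t x w) }.

Definition num_opinions (R : realType) (V : finType) (xi : V -> R) : nat :=
  size (undup (codom xi)).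

(* The limit exists almost surely; where it does not, [lim] is [point = 0]. *)
Definition nu d (Omega : measurableType d) (R : realType)
    (P : probability Omega R) (V : finType) (eta : R -> V -> {RV P >-> R})
    (w : Omega) : nat :=
  lim (num_opinions (fun x => eta t x w) @[t --> +oo]).

Definition consensus d (Omega : measurableType d) (R : realType)
    (P : probability Omega R) (V : finType) (eta : R -> V -> {RV P >-> R})
    : set Omega :=
  [set w | exists t0 : R,
    forall t : R, t0 <= t -> forall x y, eta t x w = eta t y w].

(* Main.v *)
Require Import Defs.
From mathcomp Require Import all_boot all_order all_algebra.
From mathcomp Require Import all_classical all_reals all_analysis.
From mathcomp Require Import ring lra zify.

Set Implicit Arguments.
Unset Strict Implicit.
Unset Printing Implicit Defensive.

Import Order.TTheory GRing.Theory Num.Theory.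
Import numFieldNormedType.Exports.

Local Open Scope classical_set_scope.
Local Open Scope ring_scope.

(** Call an opinion centrist when it lies in [1 - eps, eps], a nonempty
    interval because eps > 1/2. A centrist is within eps of every opinion, so
    an update of y by x is carried out as soon as one of x, y is centrist;
    when neither is, carrying it out or not leaves y non-centrist. Hence the
    set of centrist vertices follows the plain voter model: y becomes centrist
    exactly when x is ([centrist_adopt]). Tracing updates backwards, a vertex is
    centrist at time t iff its ancestor at time 0 was, and the ancestor is a
    function of the clocks alone, hence independent of the initial opinions
    ([centrist_run]). So, given the clocks, any vertex chosen from them is
    centrist with probability 2 eps - 1.

    Fix a vertex r. Since G is connected there is a finite word A of directed
    edges which, rung in this order, copies the opinion of r to all of V,
    provided r is centrist at the start ([spreading_word]). Almost surely the
    clocks spell A in consecutive rings at some time; with probability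
    2 eps - 1 the vertex r is centrist at the beginning of that stretch, and
    then consensus is reached at its end and persists ([consensus_persists]).

    This reasoning conditions on the whole order of the rings. To stay with
    finitely many events, time is cut in cells of length h, and the clocks are
    described by the word giving for each cell the edge of its only ring, or
    none. The joint law of such a word and of one initial opinion is an explicit
    product ([prob_clock_word]), so that probabilities become weighted sums over
    words ([prob_word_event]). Over L cells the total mass of the words is at
    least 1 - L (D h)^2, with D the number of directed edges
    ([cell_mass_pow_ge]): this tends to 1 as h tends to 0 at fixed L h, which
    also shows that two clocks almost surely never ring together
    ([collision_negligible]). The mass of the words that avoid A decays
    geometrically in the time L h, at a rate that does not depend on h
    ([word_sum_avoids]). Refining the cells and then letting the time grow gives
    the bound ([consensus_prob_ge]). *)

(** * Centrist opinions and words of updates *)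

Section words.
Context (R : realType) (V : finType) (e : rel V) (eps : R).
Implicit Types (xi : V -> R) (A : seq (directed_edge e)).

Definition centrist (c : R) := 1 - eps <= c <= eps.

Definition unit_opinions xi := forall z, 0 <= xi z <= 1.

Lemma centrist_close c c' : centrist c -> 0 <= c' <= 1 -> `|c - c'| <= eps.
Proof.
by rewrite /centrist ler_norml => /andP[? ?] /andP[? ?]; apply/andP; split; lra.
Qed.

Definition run A xi := foldl (fun xi a => adopt eps (val a) xi) xi A.

Lemma run_cat A B xi : run (A ++ B) xi = run B (run A xi).
Proof. exact: foldl_cat. Qed.

Lemma unit_adopt a xi : unit_opinions xi -> unit_opinions (adopt eps a xi).
Proof. by move=> xi01 z; rewrite /adopt; case: ifP. Qed.

Lemma unit_run A xi : unit_opinions xi -> unit_opinions (run A xi).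
Proof. by elim: A xi => //= a A IH xi xi01; exact/IH/unit_adopt. Qed.

Definition source (a : V * V) (z : V) := if z == a.2 then a.1 else z.

(** The vertex from which the state of [z] after the rings [A] would be
    inherited if all updates were carried out. *)
Definition ancestor A (z : V) := foldr (fun a => source (val a)) z A.

(** If both ends of the edge are non-centrist, the update may or may not happen,
    but the vertex stays non-centrist either way; otherwise it does happen.
    Centrism therefore evolves as if the threshold were absent. *)
Lemma centrist_adopt a xi z : unit_opinions xi ->
  centrist (adopt eps a xi z) = centrist (xi (source a z)).
Proof.
move=> xi01; rewrite /adopt /source; case: eqP => [->|//] /=.
case: ifPn => // far.
have nc1 : centrist (xi a.1) = false.
  by apply: contraNF far => c1; exact: centrist_close.
rewrite nc1; apply: contraNF far => c2.
by rewrite distrC; exact: centrist_close.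
Qed.

Lemma centrist_run A xi z : unit_opinions xi ->
  centrist (run A xi z) = centrist (xi (ancestor A z)).
Proof.
elim: A xi => //= a A IH xi xi01.
by rewrite IH ?centrist_adopt//; exact: unit_adopt.
Qed.

(** Consensus is absorbing. *)
Lemma run_const A xi : (forall x y, xi x = xi y) ->
  forall x y, run A xi x = run A xi y.
Proof.
elim: A xi => //= a A IH xi xic; apply: IH => x y.
by rewrite /adopt; do 2! case: ifP => _.
Qed.

(** The word [A] transports a centrist opinion of [r] itself, not merely the
    property of being centrist, to the whole graph. *)
Definition spreads r A := forall xi, unit_opinions xi -> centrist (xi r) ->
  forall z, run A xi z = xi r.

(** Ringing the edges of a path in order carries the opinion of its origin
    along. The second clause, that copies of this opinion already present are
    not destroyed, allows words for different paths to be concatenated; it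
    holds because each ringing edge starts at a vertex holding the opinion. *)
Lemma path_word x p : path e x p -> exists A, forall xi,
  unit_opinions xi -> centrist (xi x) ->
  run A xi (last x p) = xi x /\ (forall z, xi z = xi x -> run A xi z = xi x).
Proof.
elim: p x => [|y p IH] x /=; first by move=> _; exists [::].
move=> /andP[exy /IH[A HA]].
exists (exist (fun a : V * V => e a.1 a.2) (x, y) exy :: A) => xi xi01 cx /=.
set xi' := adopt _ _ _.
have xi'y : xi' y = xi x.
  by rewrite /xi' /adopt eqxx /= centrist_close.
have [||H1 H2] := HA xi'; [exact: unit_adopt|by rewrite xi'y|].
rewrite xi'y in H1 H2; split=> // z zx; apply: H2.
by rewrite /xi' /adopt; case: ifP.
Qed.

Lemma spreading_word r : (forall x, connect e r x) -> exists A, spreads r A.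
Proof.
move=> conn.
(* Concatenate the words of paths from r to each vertex of a list. *)
have [A HA] : exists A, forall xi, unit_opinions xi -> centrist (xi r) ->
    forall z, z \in enum V \/ xi z = xi r -> run A xi z = xi r.
  elim: (enum V) => [|x s [A HA]]; first by exists [::] => xi _ _ z [].
  have [p /path_word[B HB] xp] := connectP (conn x).
  exists (B ++ A) => xi xi01 cr z zs; rewrite run_cat.
  have [H1 H2] := HB _ xi01 cr; rewrite -xp in H1.
  have Br : run B xi r = xi r by exact: H2.
  rewrite HA ?Br//; first exact: unit_run.
  case: zs => [|/H2]; last by right.
  by rewrite inE => /predU1P[->|]; [right|left].
by exists A => xi xi01 cr z; apply: HA => //; left; rewrite mem_enum.
Qed.

(** Just before an occurrence of [A], the vertex [r] is centrist iff its ancestor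
    was so initially: a single initial opinion guarantees consensus. *)
Lemma ancestor_spreading_consensus A l r xi : unit_opinions xi ->
  spreads r A -> forall p s, l = p ++ A ++ s -> centrist (xi (ancestor p r)) ->
  forall x y, run l xi x = run l xi y.
Proof.
move=> xi01 HA p s -> cr; rewrite !run_cat; apply: run_const => x y.
by rewrite !HA//; do ?[exact: unit_run]; rewrite centrist_run.
Qed.

End words.

(** * Weighted sums over words *)

Section word_sums.
Context (R : realType) (E : finType) (h : R).
Hypothesis h_ge0 : 0 <= h.

Definition letters (v : seq (option E)) : seq E := pmap id v.

(** With independent rate 1 clocks indexed by [E], the probability that during
    a time [h] the only ring is the one of [o], or that there is none. *)
Definition letter_weight (o : option E) : R :=
  expR (- (#|E|%:R * h)) * (if o is Some _ then h else 1).

Lemma letter_weight_ge0 o : 0 <= letter_weight o.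
Proof. by rewrite mulr_ge0 ?expR_ge0//; case: o. Qed.

(** The probability of at most one ring during a time [h]. *)
Definition cell_mass : R := expR (- (#|E|%:R * h)) * (1 + #|E|%:R * h).

Lemma sum_option (F : option E -> R) :
  \sum_o F o = F None + \sum_a F (Some a).
Proof.
rewrite (bigD1 None)//=; congr +%R.
rewrite (reindex_omap Some id)/=; last by case.
by apply: eq_bigl => a; rewrite eqxx.
Qed.

Lemma sum_letter_weight : \sum_o letter_weight o = cell_mass.
Proof.
rewrite sum_option /letter_weight sumr_const /cell_mass mulrDr.
by rewrite (mulr_natl h) mulrnAr.
Qed.

(** The integral of [f] over the words of length [L] for the product measure
    of the letter weights. Peeling off one letter at a time makes the
    decomposition along a concatenation, [word_sum_cat], immediate. *)
Fixpoint word_sum (L : nat) (f : seq (option E) -> R) : R :=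
  if L is L'.+1 then
    \sum_o letter_weight o * word_sum L' (fun v => f (o :: v))
  else f [::].

Lemma ler_word_sum L f g : (forall v, f v <= g v) ->
  word_sum L f <= word_sum L g.
Proof.
elim: L f g => [|L IH] f g fg //=; apply: ler_sum => o _.
by rewrite ler_wpM2l ?letter_weight_ge0// IH.
Qed.

Lemma eq_word_sum L f g : f =1 g -> word_sum L f = word_sum L g.
Proof. by move=> fg; apply/eqP; rewrite eq_le !ler_word_sum// => v; rewrite fg. Qed.

Lemma word_sum_ge0 L f : (forall v, 0 <= f v) -> 0 <= word_sum L f.
Proof.
elim: L f => [|L IH] f f0 //=; apply: sumr_ge0 => o _.
by rewrite mulr_ge0 ?letter_weight_ge0// IH.
Qed.

Lemma word_sumB L f g :
  word_sum L (fun v => f v - g v) = word_sum L f - word_sum L g.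
Proof.
elim: L f g => //= L IH f g; rewrite -sumrB; apply: eq_bigr => o _.
by rewrite IH mulrBr.
Qed.

Lemma word_sumZ L c f : word_sum L (fun v => c * f v) = c * word_sum L f.
Proof.
elim: L f => //= L IH f; rewrite mulr_sumr; apply: eq_bigr => o _.
by rewrite IH mulrCA.
Qed.

Lemma word_sum1 L : word_sum L (fun=> 1) = cell_mass ^+ L.
Proof. by elim: L => //= L ->; rewrite -mulr_suml sum_letter_weight exprS. Qed.

Lemma word_sum_cat L1 L2 f : word_sum (L1 + L2) f =
  word_sum L1 (fun u => word_sum L2 (fun v => f (u ++ v))).
Proof. by elim: L1 f => //= L1 IH f; apply: eq_bigr => o _; rewrite IH. Qed.

Lemma word_sum_cat_prod L1 L2 f g :
  word_sum L1 (fun u => word_sum L2 (fun v => f u * g v)) =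
  word_sum L1 f * word_sum L2 g.
Proof.
rewrite -[RHS]mulrC -word_sumZ; apply: eq_word_sum => u.
by rewrite word_sumZ mulrC.
Qed.

Definition avoids A v : R := (~~ infix A (letters v))%:R.
Definition spells A v : R := (letters v == A)%:R.

(** A word free of [A] has both halves free of [A]: indicators of avoidance
    are submultiplicative, whence the geometric decay below. *)
Lemma avoids_cat A u v : avoids A (u ++ v) <= avoids A u * avoids A v.
Proof.
rewrite /avoids /letters pmap_cat.
case: (boolP (infix A (pmap id u))) => [/(infix_catr _)->|_] /=; first by rewrite mul0r.
case: (boolP (infix A (pmap id v))) => [/(infix_catl _)->|_] /=; first by rewrite mulr0.
by rewrite mul1r lern1 leq_b1.
Qed.

Lemma spells_cat A B u v :
  spells A u * spells B v <= spells (A ++ B) (u ++ v).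
Proof.
rewrite /spells /letters pmap_cat -natrM mulnb ler_nat.
by case: eqP => // ->; case: eqP => // ->; rewrite eqxx.
Qed.

Lemma word_sum_avoids_pow A M K :
  word_sum (K * M) (avoids A) <= word_sum M (avoids A) ^+ K.
Proof.
elim: K => [|K IH]; first by rewrite mul0n expr0 /= lern1 leq_b1.
rewrite mulSn word_sum_cat exprS.
apply: le_trans (ler_wpM2l _ IH); last by apply: word_sum_ge0 => v; exact: ler0n.
rewrite -word_sum_cat_prod; apply: ler_word_sum => u; apply: ler_word_sum => v.
exact: avoids_cat.
Qed.

Lemma word_sum_spells0 L : word_sum L (spells [::]) = letter_weight None ^+ L.
Proof.
elim: L => [|L IH]; first by rewrite expr0.
rewrite exprS -IH /= sum_option big1 ?addr0// => a _.
by rewrite (@eq_word_sum _ _ (fun=> 0 * 1)) ?word_sumZ ?mul0r ?mulr0// => v; rewrite mul0r.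
Qed.

(** The single ring can be in any of the [L] cells. *)
Lemma word_sum_spells1 L a : word_sum L (spells [:: a]) =
  L%:R * h * expR (- (#|E|%:R * h)) ^+ L.
Proof.
elim: L => [|L IH]; first by rewrite !mul0r.
rewrite /= sum_option (bigD1 a)//= [X in _ + (_ + X)]big1 ?addr0; last first.
  move=> b ba.
  rewrite (@eq_word_sum _ _ (fun=> 0 * 1)) ?word_sumZ ?mul0r ?mulr0// => v.
  by rewrite ?mul0r /spells /= eqseq_cons (negbTE ba) ?mul0r.
rewrite [word_sum L _]IH.
rewrite (@eq_word_sum _ _ (spells [::])); last first.
  by move=> v; rewrite /spells /= eqseq_cons eqxx.
by rewrite word_sum_spells0 /letter_weight mulr1 -natr1 exprS; ring.
Qed.

(** Ask that each letter of [A] be rung in its own stretch of [n] cells. *)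
Lemma word_sum_spells n A :
  (n%:R * h * expR (- (#|E|%:R * h)) ^+ n) ^+ size A <=
  word_sum (size A * n) (spells A).
Proof.
elim: A => [|a A IH]; first by rewrite mul0n expr0.
rewrite mulSn word_sum_cat exprS -cat1s.
apply: (le_trans (ler_wpM2l _ IH)).
  by rewrite mulr_ge0 ?exprn_ge0 ?expR_ge0// mulr_ge0.
rewrite -(word_sum_spells1 n a) -word_sum_cat_prod.
by apply: ler_word_sum => u; apply: ler_word_sum => v; exact: spells_cat.
Qed.

Lemma bernoulli (x : R) L : 0 <= x <= 1 -> 1 - L%:R * x <= (1 - x) ^+ L.
Proof.
move=> /andP[x0 x1]; elim: L => [|L IH]; first by rewrite mul0r subr0.
rewrite exprS; apply: le_trans (ler_wpM2l _ IH); last by rewrite subr_ge0.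
rewrite -natr1; have := mulr_ge0 (mulr_ge0 (ler0n R L) x0) x0; lra.
Qed.

Lemma cell_mass_ge0 : 0 <= cell_mass.
Proof. by rewrite mulr_ge0 ?expR_ge0// addr_ge0// mulr_ge0. Qed.

Lemma cell_mass_le1 : cell_mass <= 1.
Proof.
rewrite -[leRHS](expR0) -[X in expR X](addNr (#|E|%:R * h)) expRD.
by rewrite ler_wpM2l ?expR_ge0 ?expR_ge1Dx.
Qed.

(** Since exp (- x) >= 1 - x, one cell has mass at least 1 - x ^ 2 with
    x = D h. Two rings in one cell are a second order event. *)
Lemma cell_mass_pow_ge L : #|E|%:R * h <= 1 ->
  1 - L%:R * (#|E|%:R * h) ^+ 2 <= cell_mass ^+ L.
Proof.
move=> Dh1; set x := #|E|%:R * h.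
have x0 : 0 <= x by rewrite mulr_ge0.
have x21 : 0 <= x ^+ 2 <= 1 by rewrite exprn_ge0//= exprn_ile1.
apply: (le_trans (bernoulli L x21)).
rewrite lerXn2r ?nnegrE ?subr_ge0 ?cell_mass_ge0//; first by case/andP: x21.
have -> : 1 - x ^+ 2 = (1 - x) * (1 + x) by ring.
by rewrite ler_wpM2r ?expR_ge1Dx ?addr_ge0.
Qed.

(** When n h = 1 the base of the power is 1 - exp (- D) ^ |A|, whatever the mesh. *)
Lemma word_sum_avoids n K A :
  word_sum (K * (size A * n)) (avoids A) <=
  (1 - (n%:R * h * expR (- (#|E|%:R * h)) ^+ n) ^+ size A) ^+ K.
Proof.
set q := (_ ^+ size A); apply: (le_trans (word_sum_avoids_pow _ _ _)).
(* Words that spell exactly A form part of those that contain it. *)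
have H : word_sum (size A * n) (avoids A) <= 1 - q.
  apply: (@le_trans _ _ (word_sum (size A * n) (fun v => 1 - spells A v))).
    apply: ler_word_sum => v; rewrite /avoids /spells.
    have [->|_] := eqVneq (letters v) A; first by rewrite infix_refl subrr.
    by rewrite subr0 lern1 leq_b1.
  rewrite word_sumB word_sum1 lerB ?word_sum_spells//.
  by rewrite exprn_ile1 ?cell_mass_ge0 ?cell_mass_le1.
have A0 : 0 <= word_sum (size A * n) (avoids A).
  by apply: word_sum_ge0 => v; exact: ler0n.
by rewrite lerXn2r ?nnegrE ?(le_trans A0 H).
Qed.

End word_sums.

(** * Trajectories driven by counting paths *)

Section counting_paths.
Context (R : realType).
Implicit Types (n : R -> nat) (s t u r : R).

Lemma counting_path_locally_const n t : counting_path n -> 0 <= t ->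
  \forall r \near t^'+, n r = n t.
Proof. by move=> [_ _ rc] t0; exact: (rc t t0 _ (discrete_set1 (n t))). Qed.

Lemma no_point n s t : counting_path n -> 0 <= s -> n s = n t ->
  forall u, s < u -> u <= t -> ~ points n u.
Proof.
move=> [_ mon _] s0 nst u su ut [_ /(_ s s0 su)].
by rewrite nst ltnNge mon// (le_trans s0)// ltW.
Qed.

(** A counting path that increases does so at a point: the infimum of the
    times where it exceeds its initial value, which is attained by
    right-continuity. *)
Lemma first_point n s t : counting_path n -> 0 <= s -> s <= t ->
  (n s < n t)%N ->
  exists u, [/\ s < u, u <= t, points n u &
    forall r, s <= r -> r < u -> n r = n s].
Proof.
move=> cp s0 st nst; have [_ mon _] := cp.
pose S := [set r | s <= r /\ (n s < n r)%N].
have St : S t by [].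
have lbS : lbound S s by move=> r [].
have hlS : has_lbound S by exists s.
have su : s <= inf S by apply: lb_le_inf => //; exists t.
have before r : s <= r -> r < inf S -> n r = n s.
  move=> sr rS; apply/eqP; rewrite eqn_leq (mon s r)// andbT leqNgt.
  apply/negP => nsr; have : inf S <= r by exact: ge_inf.
  by rewrite leNgt rS.
have nsu : (n s < n (inf S))%N.
  rewrite ltnNge; apply/negP => nus.
  have nuE : n (inf S) = n s by apply/eqP; rewrite eqn_leq nus mon.
  have := counting_path_locally_const cp (le_trans s0 su).
  rewrite nuE => /nbhs_right0P nearu.
  have [d /= d0 Hd] := nearu.
  have [|r [sr nsr] rd] := @inf_adherent _ S (d / 2) _ (conj (ex_intro _ t St) hlS).
    by rewrite divr_gt0.
  have ur : inf S <= r by exact: ge_inf.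
  move: ur; rewrite le_eqVlt => /predU1P[ur|ur].
    by move: nsr; rewrite -ur nuE ltnn.
  have /Hd : ball 0 d (r - inf S).
    by rewrite /ball /= sub0r normrN gtr0_norm ?subr_gt0//; lra.
  rewrite subr_gt0 => /(_ ur); rewrite addrC subrK => nrs.
  by move: nsr; rewrite nrs ltnn.
exists (inf S); split => //.
- by rewrite lt_neqAle su andbT; apply/eqP => suE; move: nsu; rewrite -suE ltnn.
- exact: ge_inf.
- split => [|r r0 ru].
    rewrite lt_neqAle (le_trans s0 su) andbT; apply/eqP => u0.
    move: nsu; rewrite -u0 => /leq_trans/(_ (mon _ _ (lexx 0) s0)).
    by rewrite ltnn.
  have [sr|rs] := leP s r; first by rewrite before.
  by apply: (leq_ltn_trans _ nsu); rewrite mon// ltW.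
Qed.

End counting_paths.

Section trajectories.
Context (R : realType) (V : finType) (e : rel V) (eps : R).
Variables (n : directed_edge e -> R -> nat) (xi : R -> V -> R).
Hypothesis n_counting : forall a, counting_path (n a).
Hypothesis xi_driven : driven_by eps n xi.

Lemma driven_cell s t (o : option (directed_edge e)) : 0 <= s -> s <= t ->
  (forall a, (n a t - n a s)%N = (o == Some a)) ->
  xi t = run eps (oapp (cons^~ [::]) [::] o) (xi s).
Proof.
have [hconst hjump] := xi_driven.
move=> s0 st inc; have mon a : (n a s <= n a t)%N by have [_ + _] := n_counting a; exact.
have same b : o != Some b -> n b s = n b t.
  by move=> ob; have := inc b; have := mon b; case: eqP ob => //; lia.
case: o inc same => [a|] inc same /=; last first.
  apply/funext => z; apply: hconst => // b r sr rt.
  by apply: no_point sr rt => //; exact: same.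
have na : n a t = (n a s).+1 by have := inc a; have := mon a; rewrite eqxx; lia.
have others b : b != a -> n b s = n b t.
  by move=> ba; apply: same; apply: contraNN ba => /eqP[->].
have [|u [su ut pu before]] := first_point (n_counting a) s0 st; first by rewrite na.
have u0 : 0 <= u by rewrite (le_trans s0)// ltW.
have nau : n a u = n a t.
  apply/eqP; rewrite eqn_leq; apply/andP; split.
    by have [_ + _] := n_counting a; apply.
  by rewrite na; have [_ + ] := pu; apply.
apply/funext => z; rewrite -(hjump s u a s0 su)//.
- apply: hconst => // b r ur rt.
  have [->|ba] := eqVneq b a; first exact: no_point ur rt.
  by apply: (no_point _ _ (others b ba)) rt => //; exact: lt_trans ur.
- by move=> b ba; apply: (no_point _ _ (others b ba)).
- move=> b r sr ru.
  have [->|ba] := eqVneq b a.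
    by move=> [_ /(_ s s0 sr)]; rewrite before ?ltnn// ltW.
  apply: (no_point _ _ (others b ba)) => //.
  by rewrite (le_trans _ ut)// ltW.
Qed.

(** [v] records the rings up to time [size v * h] at the resolution [h]: the
    clock [a] rings once in cell [i] if the letter there is [Some a], and does
    not ring otherwise. A path with two rings in one cell has no such word. *)
Definition cell_word (h : R) (v : seq (option (directed_edge e))) :=
  forall i, (i < size v)%N -> forall a,
    (n a (i.+1%:R * h) - n a (i%:R * h))%N = (nth None v i == Some a).

Lemma cell_word_rcons h v o : cell_word h (rcons v o) <->
  cell_word h v /\ forall a,
    (n a ((size v).+1%:R * h) - n a ((size v)%:R * h))%N = (o == Some a).
Proof.
split=> [H|[H1 H2]].
  split=> [i iv a|a].
    by rewrite H ?size_rcons ?nth_rcons ?iv// ltnW.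
  by rewrite H ?size_rcons ?nth_rcons ?ltnn ?eqxx.
move=> i; rewrite size_rcons ltnS leq_eqVlt => /predU1P[->|iv] a.
  by rewrite nth_rcons ltnn eqxx H2.
by rewrite nth_rcons iv H1.
Qed.

Lemma driven_cell_word h v : 0 <= h -> cell_word h v ->
  xi ((size v)%:R * h) = run eps (letters v) (xi 0).
Proof.
move=> h0; elim/last_ind: v => [_|v o IH /cell_word_rcons[Hv Ho]].
  by rewrite mul0r.
rewrite size_rcons (driven_cell _ _ Ho) ?ler_wpM2r ?ler_nat ?mulr_ge0//.
rewrite IH// /letters -cats1 pmap_cat run_cat.
by case: (o).
Qed.

Definition simultaneous_points (T : R) := exists a b : directed_edge e,
  a != b /\ exists2 u, u <= T & points (n a) u /\ points (n b) u.

(** Two clocks ringing together would share a cell, whose letter would have to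
    name both. *)
Lemma cell_word_no_simultaneous h v : 0 < h -> cell_word h v ->
  ~ simultaneous_points ((size v)%:R * h).
Proof.
move=> h0 Hv [a [b [ab [u uT [[u0 pa] [_ pb]]]]]].
have [i [iv iu ui]] : exists i, [/\ (i < size v)%N, i%:R * h < u & u <= i.+1%:R * h].
  elim: (size v) uT => [|k IH] uT.
    by move: uT; rewrite mul0r leNgt u0.
  have [/IH[i [ik iu ui]]|ku] := leP u (k%:R * h).
    by exists i; split => //; exact: leqW.
  by exists k.
have inc c : (forall s, 0 <= s -> s < u -> (n c s < n c u)%N) -> nth None v i = Some c.
  move=> pc; have := Hv i iv c; case: eqP => // _ inc0.
  have [_ mon _] := n_counting c.
  have := pc _ _ iu; have := mon u _ (ltW u0) ui.
  have ih0 : 0 <= i%:R * h by rewrite mulr_ge0// ltW.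
  move=> le_u /(_ ih0) lt_u; exfalso; rewrite /= in inc0.
  move: (n c _) (n c _) (n c _) le_u lt_u inc0 => x y z; lia.
by move: ab; have := inc a pa; rewrite (inc b pb) => -[->]; rewrite eqxx.
Qed.

(** Induction on the total number of rings left before [t]: nothing moves up to
    the next ring, and a single ring leaves a constant configuration
    constant. Simultaneous rings must be excluded because the dynamics does
    not prescribe the configuration there. *)
Lemma consensus_persists t0 t : 0 <= t0 -> t0 <= t ->
  ~ simultaneous_points t ->
  (forall x y, xi t0 x = xi t0 y) -> forall x y, xi t x = xi t y.
Proof.
have [hconst hjump] := xi_driven.
(* The superposition of all clocks is again a counting path. *)
pose S r := (\sum_a n a r)%N.
have S_counting : counting_path S.
  split.
  - by rewrite /S big1// => a _; have [] := n_counting a.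
  - by move=> s u s0 su; apply: leq_sum => a _; have [_ + _] := n_counting a; apply.
  - move=> u u0; apply: cvg_near_cst.
    have : \forall r \near u^'+, forall a, n a r = n a u.
      apply: filter_forall => a; exact: counting_path_locally_const.
    by apply: filterS => r nr; apply: eq_bigr.
have monS s u : 0 <= s -> s <= u -> (S s <= S u)%N by have [_ + _] := S_counting; apply.
have mon a s u : 0 <= s -> s <= u -> (n a s <= n a u)%N.
  by have [_ + _] := n_counting a; apply.
have freeze s u : 0 <= s -> s <= u -> S u = S s -> forall a, n a u = n a s.
  move=> s0 su Ssu a; apply/eqP; rewrite eqn_leq (mon a s u)// andbT leqNgt.
  apply/negP => lt_a; suff : (S s < S u)%N by rewrite Ssu ltnn.
  rewrite /S (bigD1 a)//= [X in (_ < X)%N](bigD1 a)//= -addSn leq_add//.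
  by apply: leq_sum => b _; exact: mon.
move=> t00 t0t nosim.
have [k] := ubnP (S t - S t0)%N; elim: k t0 t00 t0t => // k IH t0 t00 t0t.
rewrite ltnS => Sk cons.
have [St|St] := leqP (S t) (S t0).
  have nE a : n a t0 = n a t.
    by apply/esym/freeze => //; apply/eqP; rewrite eqn_leq St monS.
  have xE z : xi t z = xi t0 z.
    by apply: hconst => // b r r1 r2; apply: no_point r1 r2.
  by move=> x y; rewrite !xE.
have [u [t0u ut [u0 pu] before]] := first_point S_counting t00 t0t St.
apply: (IH u) => //; first exact: ltW.
  have := monS u t (ltW u0) ut; have := pu t0 t00 t0u; lia.
have frozen a r : t0 <= r -> r < u -> n a r = n a t0.
  by move=> t0r ru; apply: freeze => //; exact: before.
have [a na] : exists a, (n a t0 < n a u)%N.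
  apply: contrapT => no; have := pu t0 t00 t0u; rewrite ltnNge => /negP; apply.
  by apply: leq_sum => b _; rewrite leqNgt; apply/negP => ?; apply: no; exists b.
have pa : points (n a) u.
  split => // s s0 su; have [ts|st] := leP t0 s; first by rewrite frozen.
  by apply: leq_ltn_trans na; apply: mon => //; exact: ltW.
move=> x y; rewrite !(hjump t0 u a)//.
- by rewrite /adopt; do 2! case: ifP => _.
- move=> b ba pb; apply: nosim; exists b, a; split => //.
  by exists u.
- move=> b r t0r ru [_ /(_ _ t00 t0r)].
  by rewrite frozen ?ltnn// ltW.
- move=> b ba pb; apply: nosim; exists b, a; split => //.
  by exists u.
- move=> b r t0r ru [_ /(_ _ t00 t0r)].
  by rewrite frozen ?ltnn// ltW.
Qed.

(** After any time there is a short interval without rings, so trajectories are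
    determined by their values at rational times. *)
Lemma driven_right_const t : 0 <= t -> \forall r \near t^'+, xi r = xi t.
Proof.
have [hconst _] := xi_driven; move=> t0.
have near_const : \forall r \near t^'+, forall a, n a r = n a t.
  by apply: filter_forall => a; exact: counting_path_locally_const.
near=> r; have tr : t < r by near: r; exact: nbhs_right_gt.
have nr : forall a, n a r = n a t by near: r.
apply/funext => z; apply: hconst => // b u tu ur.
exact: no_point (esym (nr b)) _ tu ur.
Unshelve. all: by end_near. Qed.

End trajectories.

(** * Increments of a Poisson process along a grid *)

Section sigma_family_theory.
Context d (Omega : measurableType d).

Lemma sigma_family_subset (I : Type) (D D' : set I) (X : I -> Omega -> nat) :
  D `<=` D' -> sigma_family D X `<=` sigma_family D' X.
Proof. by move=> DD'; apply: sub_sigma_algebra2; exact: bigcup_subset. Qed.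

Lemma sigma_familyI (I : Type) (D : set I) (X : I -> Omega -> nat) A B :
  sigma_family D X A -> sigma_family D X B -> sigma_family D X (A `&` B).
Proof. exact: (@measurableI _ (g_sigma_algebraType _)). Qed.

Lemma sigma_familyT (I : Type) (D : set I) (X : I -> Omega -> nat) :
  sigma_family D X setT.
Proof. exact: (@measurableT _ (g_sigma_algebraType _)). Qed.

Lemma sigma_family_preimage (I : Type) (D : set I) (X : I -> Omega -> nat) i
    (B : set nat) : D i -> sigma_family D X (X i @^-1` B).
Proof.
move=> Di; apply: sub_sigma_algebra; exists i => //.
by exists B => //; rewrite setTI.
Qed.

(** An increment is described by countably many values of its two ends. *)
Lemma sigma_family_increment (I : Type) (D : set I) (X : I -> Omega -> nat) i j k :
  D i -> D j -> sigma_family D X [set w | (X j w - X i w)%N = k].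
Proof.
move=> Di Dj.
have -> : [set w | (X j w - X i w)%N = k] =
    \bigcup_l (X i @^-1` [set l] `&` X j @^-1` [set m | (m - l)%N = k]).
  by apply/seteqP; split=> w /= => [Hw|[l _ [<-]]//]; exists (X i w).
apply: sigma_algebra_bigcup => l.
by apply: sigma_familyI; exact: sigma_family_preimage.
Qed.

End sigma_family_theory.

Section poisson_words.
Context d (Omega : measurableType d) (R : realType) (P : probability Omega R).

Definition grid_increments (N : R -> Omega -> nat) (h : R) (k : nat -> nat) L :=
  [set w | forall i, (i < L)%N ->
    (N (i.+1%:R * h)%R w - N (i%:R * h)%R w)%N = k i].

Lemma grid_incrementsS (N : R -> Omega -> nat) h k L : grid_increments N h k L.+1 =
  grid_increments N h k L `&`
  [set w | (N (L.+1%:R * h)%R w - N (L%:R * h)%R w)%N = k L].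
Proof.
apply/seteqP; split=> w /=.
  by move=> H; split=> [i iL|]; apply: H => //; exact: ltnW.
by move=> [H1 H2] i; rewrite ltnS leq_eqVlt => /predU1P[->|/H1].
Qed.

Lemma sigma_family_grid (N : R -> Omega -> nat) h k L : 0 <= h ->
  sigma_family [set r | 0 <= r <= L%:R * h] N (grid_increments N h k L).
Proof.
move=> h0; elim: L => [|L IH].
  have -> : grid_increments N h k 0 = setT by apply/seteqP; split.
  exact: sigma_familyT.
have LS : L%:R * h <= L.+1%:R * h by rewrite ler_wpM2r// ler_nat.
have L0 : 0 <= L%:R * h by rewrite mulr_ge0.
rewrite grid_incrementsS; apply: sigma_familyI.
  apply: sigma_family_subset IH => r /= /andP[-> rL] /=.
  exact: le_trans LS.
by apply: sigma_family_increment; rewrite /= ?lexx ?LS ?L0 ?(le_trans L0).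
Qed.

(** Independence of each increment from the past, applied along the grid; the
    event on the first [L] cells belongs to the past of time [L * h]. *)
Lemma grid_increments_prob (N : R -> {RV P >-> nat}) h k L : 0 < h ->
  is_poisson_process 1 N ->
  P (grid_increments N h k L) = (\prod_(i < L) poisson_pmf h (k i))%:E.
Proof.
move=> h0 pN; elim: L => [|L IH].
  have -> : grid_increments N h k 0 = setT by apply/seteqP; split.
  by rewrite probability_setT big_ord0.
have L0 : 0 <= L%:R * h by rewrite mulr_ge0// ltW.
have LS : L%:R * h < L.+1%:R * h by rewrite ltr_pM2r// ltr_nat.
rewrite grid_incrementsS big_ord_recr/= EFinM -IH.
have := poisson_increment_indep pN L0 LS [set k L]
  (@sigma_family_grid (fun t => N t) h k L (ltW h0)).
move=> ->; congr (_ * _)%E.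
have := poisson_increment_law pN (k L) L0 LS.
by rewrite -mulrBl -natrB// subSnn !mul1r.
Qed.

End poisson_words.

(** * The law of the word of rings *)

Section opinion_process.
Context d (Omega : measurableType d) (R : realType) (P : probability Omega R)
  (V : finType) (e : rel V) (eps : R).
Variables (N : directed_edge e -> R -> {RV P >-> nat})
  (eta : R -> V -> {RV P >-> R}).
Hypothesis process : is_opinion_process eps N eta.

Implicit Types (h : R).
Local Notation edge := (directed_edge e).

Definition clock_word (h : R) (v : seq (option edge)) : set Omega :=
  [set w | cell_word (fun a t => N a t w) h v].

Lemma clocks_counting w a : counting_path (fun t => N a t w).
Proof. exact: (poisson_path (opinion_clocks process a)). Qed.

Lemma dynamics w : driven_by eps (fun a t => N a t w) (fun t x => eta t x w).
Proof. exact: (opinion_dynamics process). Qed.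

Definition incr_count (v : seq (option edge)) (a : edge) (i : nat) : nat :=
  nth None v i == Some a.

Lemma clock_wordE h v : clock_word h v =
  \bigcap_a grid_increments (fun t => N a t) h (incr_count v a) (size v).
Proof.
apply/seteqP; split=> w /=; first by move=> H a _ i iv; exact: H.
by move=> H i iv a; exact: H.
Qed.

Lemma measurable_grid a h k L :
  measurable (grid_increments (fun t => N a t) h k L).
Proof.
have -> : grid_increments (fun t => N a t) h k L = \bigcap_i
    (if (i < L)%N then \bigcup_l (N a (i%:R * h) @^-1` [set l] `&`
      N a (i.+1%:R * h) @^-1` [set m | (m - l)%N = k i]) else setT).
  apply/seteqP; split=> w /=.
    move=> H i _; case: ifP => // iL; exists (N a (i%:R * h) w) => //.
    by split => //=; exact: H.
  move=> H i iL; have := H i I; rewrite iL => -[l _ /= [<-]].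
  by [].
apply: bigcapT_measurable => i; case: ifP => // _.
apply: bigcupT_measurable => l; apply: measurableI;
  by rewrite -[X in measurable X]setTI; exact: measurable_funP.
Qed.

Lemma measurable_clock_word h v : measurable (clock_word h v).
Proof.
rewrite clock_wordE; apply: fin_bigcap_measurable => [|a _].
  exact: finite_finset.
exact: measurable_grid.
Qed.

Lemma prod_letter_weight h (o : option edge) : 0 < h ->
  \prod_a poisson_pmf h (o == Some a) = letter_weight h o.
Proof.
move=> h0; under eq_bigr => a _.
  rewrite /poisson_pmf h0.
  have -> : h ^+ (o == Some a) * (o == Some a)`!%:R^-1 = if o == Some a then h else 1.
    by case: (o == _); rewrite ?expr1 ?expr0 ?invr1 ?mulr1.
  over.
rewrite big_split /= prodr_const -expRM_natl mulrN mulrC; congr (_ * _).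
case: o => [b|]; last by rewrite big1.
rewrite (bigD1 b)//= eqxx big1 ?mulr1// => a ab.
by rewrite (inj_eq Some_inj) eq_sym (negbTE ab).
Qed.

(** Clocks and initial opinions being mutually independent, the probability of a
    word is a product over edges of products over cells. Exchanging the two
    products gathers, cell by cell, the weight of a letter. *)
Lemma prob_clock_word h v y (B : set R) : 0 < h -> measurable B ->
  P (clock_word h v `&` (eta 0 y @^-1` B)) =
  ((\prod_(o <- v) letter_weight h o)%:E * uniform_prob (@ltr01 R) B)%E.
Proof.
move=> h0 mB.
(* One event per independent source, trivial for the vertices other than y. *)
pose A (i : V + edge) : set Omega := match i with
  | inl x => if x == y then eta 0 y @^-1` B else setT
  | inr a => grid_increments (fun t => N a t) h (incr_count v a) (size v)
  end.
have -> : clock_word h v `&` (eta 0 y @^-1` B) =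
    \bigcap_(i in [set` [set: V + edge]%SET]) A i.
  rewrite clock_wordE; apply/seteqP; split=> w.
    move=> [H1 H2] [x|a] _ /=; last exact: H1.
    by case: ifP.
  move=> H; split=> [a _|]; first exact: (H (inr a) (finset.in_setT _)).
  by have := H (inl y) (finset.in_setT _); rewrite /= eqxx.
have := opinion_indep process; move=> /(_ [set: V + edge]%SET A) -> ; last first.
  case=> [x|a] _ /=.
    case: eqP => [->|_]; first by exists B => //; rewrite setTI.
    by exists setT => //; rewrite setTI preimage_setT.
  have := @sigma_family_grid _ _ _ (fun t => N a t) h (incr_count v a) (size v) (ltW h0).
  by apply: sigma_family_subset => r /= /andP[].
transitivity (\prod_i P (A i))%E; first by apply: eq_bigl => i; rewrite finset.in_setT.
rewrite big_sumType /= muleC; congr (_ * _)%E; last first.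
  rewrite (bigD1 y)//= eqxx big1 => [|x /negbTE ->]; last exact: probability_setT.
  by rewrite mule1; have := opinion_initial process y mB.
rewrite (eq_bigr (fun a =>
  (\prod_(i < size v) poisson_pmf h (incr_count v a i))%:E)); last first.
  by move=> a _; apply: grid_increments_prob => //; exact: (opinion_clocks process).
rewrite prodEFin; congr EFin; rewrite exchange_big /=.
rewrite (big_nth None) big_mkord; apply: eq_bigr => i _.
exact: prod_letter_weight.
Qed.

(** The word of the next [L] cells after the prefix [u], jointly with an
    event [X] that may depend on the whole word. *)
Definition word_event (X : seq (option edge) -> set Omega) h u L : set Omega :=
  [set w | exists v, [/\ size v = L, clock_word h (u ++ v) w & X (u ++ v) w]].

Lemma word_event0 X h u : word_event X h u 0 = clock_word h u `&` X u.
Proof.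
apply/seteqP; split=> w /= [].
  by move=> v [/size0nil ->]; rewrite cats0.
by move=> H1 H2; exists [::]; rewrite cats0.
Qed.

Lemma word_eventS X h u L : word_event X h u L.+1 =
  \bigcup_(o in setT) word_event X h (rcons u o) L.
Proof.
apply/seteqP; split=> w /=.
  move=> [ [|o v] []] //= [sv] H1 H2; exists o => //; exists v.
  by rewrite !cat_rcons.
move=> [l _ [v [sv]]]; rewrite !cat_rcons => H1 H2; exists (l :: v).
by rewrite /= sv.
Qed.

Lemma measurable_word_event X h u L : (forall v, measurable (X v)) ->
  measurable (word_event X h u L).
Proof.
move=> mX; elim: L u => [|L IH] u.
  by rewrite word_event0; apply: measurableI => //; exact: measurable_clock_word.
by rewrite word_eventS; apply: fin_bigcup_measurable => //; exact: finite_finset.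
Qed.

(** Words are disjoint events, hence probabilities add up. The prefix [u] is
    what makes the induction on the number of remaining cells go through. *)
Lemma prob_word_event X (x : seq (option edge) -> R) h u L : 0 < h ->
  (forall v, measurable (X v)) ->
  (forall v, P (clock_word h v `&` X v) =
    ((\prod_(o <- v) letter_weight h o) * x v)%:E) ->
  P (word_event X h u L) = ((\prod_(o <- u) letter_weight h o) *
    word_sum h L (fun v => x (u ++ v)))%:E.
Proof.
move=> h0 mX PX; elim: L u => [|L IH] u.
  by rewrite word_event0 PX /= cats0.
rewrite word_eventS measure_fin_bigcup; last 3 first.
- exact: finite_finset.
(* Distinct letters at position size u prescribe different increments of
   some clock. *)
- move=> o o' _ _ [w [[v [_ H _]] [v' [_ H' _]]]].
  apply: contrapT => /eqP oo'.
  have := H (size u); rewrite size_cat size_rcons ltnS leq_addr => /(_ isT).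
  have := H' (size u); rewrite size_cat size_rcons ltnS leq_addr => /(_ isT).
  rewrite !cat_rcons !nth_cat !ltnn !subnn /= => E1 E2.
  case: o o' oo' E1 E2 {H H'} => [a|] [b|]//= oo'.
  + by move=> /(_ a) + /(_ a) => -> /=; rewrite eqxx (inj_eq Some_inj) eq_sym;
      rewrite (inj_eq Some_inj) in oo'; rewrite (negbTE oo').
  + by move=> /(_ a) + /(_ a) => ->; rewrite eqxx.
  + by move=> /(_ b) + /(_ b) => ->; rewrite eqxx.
- by move=> o _; exact: measurable_word_event.
rewrite (fsbig_fwiden (enum {: option edge})) ?enum_uniq//=; last 2 first.
- by move=> o _ /=; rewrite mem_enum.
- by move=> o [_ []].
rewrite big_enum /= (eq_bigr (fun o => ((\prod_(o <- u) letter_weight h o) *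
   (letter_weight h o * word_sum h L (fun v => x (u ++ (o :: v)))))%:E)).
  by rewrite sumEFin -mulr_sumr.
move=> o _; rewrite IH -cats1 big_cat big_seq1 mulrA; congr (_ * _)%:E.
by apply: eq_word_sum => [|v]; [exact: ltW|rewrite -catA].
Qed.

End opinion_process.

(** * Consensus *)

Lemma fine_mesh (R : realType) (D c delta : R) : 0 <= D -> 0 <= c -> 0 < delta ->
  exists n, D * n.+1%:R^-1 <= 1 /\ c * n.+1%:R^-1 <= delta.
Proof.
move=> D0 c0 d0; exists (Num.truncn (D + c / delta)).
have := truncnS_gt (D + c / delta); set n := (_.+1) => Hn.
have n0 : 0 < n%:R :> R by rewrite ltr0n.
have cd0 : 0 <= c / delta by rewrite divr_ge0// ltW.
rewrite !ler_pdivrMr// mul1r; split; first by rewrite ltW// (le_lt_trans _ Hn)// lerDl.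
by rewrite -ler_pdivrMl// mulrC ltW// (le_lt_trans _ Hn)// lerDr.
Qed.

Lemma num_opinions_eq1 (R : realType) (V : finType) (xi : V -> R) : (0 < #|V|)%N ->
  num_opinions xi = 1%N <-> forall x y, xi x = xi y.
Proof.
move=> /card_gt0P[x0 _]; rewrite /num_opinions; split=> [|xic].
  case E : (undup (codom xi)) => [//|c [|//]] _ x y.
  have H z : xi z = c.
    by have := codom_f xi z; rewrite -mem_undup E inE => /eqP.
  by rewrite !H.
apply/eqP; rewrite eqn_leq; apply/andP; split.
  apply: (uniq_leq_size (undup_uniq _) (s2 := [:: xi x0])) => c.
  by rewrite mem_undup inE => /codomP[y ->]; rewrite (xic y x0).
by have := codom_f xi x0; rewrite -mem_undup; case: undup.
Qed.

Lemma uniform_prob_itv (R : realType) (a b : R) : 0 <= a -> a <= b -> b <= 1 ->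
  uniform_prob (@ltr01 R) `[a, b]%classic = (b - a)%:E.
Proof.
move=> a0 ab b1; rewrite /uniform_prob.
rewrite (eq_integral (fun=> 1%:E)); last first.
  move=> x; rewrite inE /= in_itv /= => /andP[ax xb]; rewrite /uniform_pdf.
  by rewrite (le_trans a0 ax) (le_trans xb b1) subr0 invr1.
rewrite integral_cst//= mul1e lebesgue_measure_itv /= lte_fin.
by move: ab; rewrite le_eqVlt => /predU1P[->|->]; rewrite ?ltxx ?subrr// EFinB.
Qed.

Section equilibrium.
Context d (Omega : measurableType d) (R : realType) (P : probability Omega R)
  (V : finType) (e : rel V) (eps : R).
Variables (N : directed_edge e -> R -> {RV P >-> nat})
  (eta : R -> V -> {RV P >-> R}).
Hypothesis process : is_opinion_process eps N eta.
Hypothesis V_nonempty : (0 < #|V|)%N.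
Implicit Types (h : R) (w : Omega).

Local Notation edge := (directed_edge e).

Definition one_at_a_time h L : set Omega := word_event N (fun=> setT) h [::] L.

Lemma measurable_one_at_a_time h L : measurable (one_at_a_time h L).
Proof. exact: measurable_word_event. Qed.

Lemma prob_one_at_a_time h L : 0 < h ->
  P (one_at_a_time h L) = (cell_mass edge h ^+ L)%:E.
Proof.
move=> h0; have [y _] := card_gt0P V_nonempty.
rewrite (prob_word_event (x := fun=> 1) [::] L h0)//.
  by rewrite big_nil mul1r word_sum1.
move=> v; have := prob_clock_word process v y h0 measurableT.
by rewrite preimage_setT probability_setT mule1 mulr1.
Qed.

Definition collision (T : R) : set Omega :=
  [set w | simultaneous_points (fun a t => N a t w) T].

(** Up to time [k], a collision is incompatible with [one_at_a_time] for every
    mesh, and the complement of the latter has probability at most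
    k D ^ 2 h, which is arbitrarily small. *)
Lemma collision_negligible : P.-negligible (\bigcup_k collision k%:R).
Proof.
apply: negligible_bigcup => k.
pose h n : R := n.+1%:R^-1.
have h0 n : 0 < h n by rewrite invr_gt0.
have kh n : (k * n.+1)%:R * h n = k%:R by rewrite natrM mulfK.
pose B := \bigcap_n ~` one_at_a_time (h n) (k * n.+1).
have mF n : measurable (~` one_at_a_time (h n) (k * n.+1)).
  exact/measurableC/measurable_one_at_a_time.
have mB : measurable B by exact: bigcapT_measurable.
exists B; split=> //; last first.
  move=> w /= Hw n _ [v [sv /= vw _]].
  apply: (cell_word_no_simultaneous (clocks_counting process w) (h0 n) vw).
  by rewrite sv kh.
apply/eqP; rewrite eq_le measure_ge0 andbT; apply/lee_addgt0Pr => delta d0.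
rewrite add0e.
pose D : R := #|{: edge}|%:R.
have [n [Dh cd]] := @fine_mesh R D (k%:R * D ^+ 2) delta (ler0n _ _)
   (mulr_ge0 (ler0n _ _) (sqr_ge0 _)) d0.
have /le_trans : (P B <= P (~` one_at_a_time (h n) (k * n.+1)))%E.
  by apply: le_measure; rewrite ?inE//; exact: bigcap_inf.
apply; rewrite probability_setC; last exact: measurable_one_at_a_time.
rewrite prob_one_at_a_time// -EFinB lee_fin.
have := cell_mass_pow_ge (ltW (h0 n)) (k * n.+1) Dh.
rewrite -/D exprMn [X in 1 - X](_ : _ = k%:R * D ^+ 2 * h n).
  by move: cd; rewrite -/(h n); set x := _ * h n; set y := _ ^+ (k * _); lra.
by rewrite -[in RHS](kh n); ring.
Qed.

(** This rewriting as a countable combination of events gives the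
    measurability of consensus. It relies on the trajectories being right-constant
    for every outcome. *)
Lemma consensusE : consensus eta = \bigcup_(k : nat) \bigcap_(q : rat)
  [set w | k%:R <= ratr q :> R -> forall x y, eta (ratr q) x w = eta (ratr q) y w].
Proof.
apply/seteqP; split=> w /=.
  move=> [t0 Ht0]; exists (Num.truncn t0).+1 => // q _ /= kq x y; apply: Ht0.
  by rewrite (le_trans _ kq)// ltW// truncnS_gt.
move=> [k _ Hk]; exists k%:R => t kt x y.
have t0 : 0 <= t by exact: le_trans kt.
have := driven_right_const (clocks_counting process w) (dynamics process w) t0.
move=> /nbhs_right0P[delta /= d0 Hd].
have [q] : exists q : rat, ratr q \in `]t, t + delta[.
  by apply: rat_in_itvoo; rewrite ltrDl.
rewrite in_itv /= => /andP[tq qd].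
have : ball 0 delta (ratr q - t).
  by rewrite /ball /= sub0r normrN gtr0_norm ?subr_gt0// ltrBlDl.
move=> /Hd; rewrite subr_gt0 => /(_ tq); rewrite addrC subrK => etaE.
have := Hk q I (le_trans kt (ltW tq)) x y.
by have := congr1 (fun f => (f x, f y)) etaE => /= -[-> ->].
Qed.

Lemma measurable_consensus : measurable (consensus eta).
Proof.
rewrite consensusE; apply: bigcupT_measurable => k.
rewrite -[X in measurable X]setCK setC_bigcap; apply: measurableC.
apply: bigcupT_measurable_rat => q; apply: measurableC.
have [kq|kq] := boolP (k%:R <= ratr q :> R); last first.
  by rewrite [X in measurable X](_ : _ = setT)//; apply/seteqP; split.
rewrite [X in measurable X](_ : _ = \bigcap_x \bigcap_y
    ((eta (ratr q) x \- eta (ratr q) y) @^-1` [set 0])); last first.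
  apply/seteqP; split=> w /= H.
    by move=> x _ y _ /=; rewrite (H isT x y) subrr.
  by move=> _ x y; apply/eqP; rewrite -subr_eq0; apply/eqP; exact: (H x I y I).
apply: fin_bigcap_measurable => [|x _]; first exact: finite_finset.
apply: fin_bigcap_measurable => [|y _]; first exact: finite_finset.
rewrite -[X in measurable X]setTI.
exact: (measurable_realfun.measurable_funB (measurable_funP _)
  (measurable_funP _) measurableT).
Qed.

(** The default value of a limit that does not exist is 0, so [nu eta w = 1]
    forces actual convergence; for naturals this means being eventually 1. *)
Lemma nu_eq1 : [set w | nu eta w = 1%N] = consensus eta.
Proof.
apply/seteqP; split=> w /=.
  rewrite /nu; set F := (X in lim X).
  have [/[swap] F1|/dvgP ->//] := pselect (cvg F).
  rewrite F1 => /(_ _ (discrete_set1 1%N)) [M [_ HM]].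
  exists (M + 1) => t Mt; apply/num_opinions_eq1 => //; apply: HM.
  by rewrite (lt_le_trans _ Mt)// ltrDl.
move=> [t0 Ht0]; apply: cvg_lim; first exact: discrete_hausdorff.
apply: cvg_near_cst; exists t0; split; first exact: num_real.
by move=> t /ltW tt; apply/num_opinions_eq1 => //; exact: Ht0.
Qed.

Hypotheses (eps_gt : 1 / 2 < eps) (eps_le1 : eps <= 1).

(** An interval of length 2 eps - 1, whatever the vertex and the word: this is
    where the bound of the theorem comes from. *)
Lemma prob_clock_word_centrist h v y : 0 < h ->
  P (clock_word N h v `&` [set w | centrist eps (eta 0 y w)]) =
  ((\prod_(o <- v) letter_weight h o) * (2 * eps - 1))%:E.
Proof.
move=> h0.
have -> : [set w | centrist eps (eta 0 y w)] = eta 0 y @^-1` `[1 - eps, eps].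
  by apply/seteqP; split=> w /=; rewrite in_itv.
have eps_ge : 1 - eps <= eps by move: eps_gt => ?; lra.
rewrite (prob_clock_word process)// uniform_prob_itv ?subr_ge0//.
by rewrite -EFinM; congr (_ * _)%:E; ring.
Qed.

Lemma measurable_centrist y : measurable [set w | centrist eps (eta 0 y w)].
Proof.
have -> : [set w | centrist eps (eta 0 y w)] = eta 0 y @^-1` `[1 - eps, eps].
  by apply/seteqP; split=> w /=; rewrite in_itv.
by rewrite -[X in measurable X]setTI; exact: measurable_funP.
Qed.

(** The event used covers K |A| units of time, each cut in [n.+1] cells: the word
    of the clocks contains [A], and the ancestor of [r] at the beginning of
    this occurrence is initially centrist. *)
Lemma consensus_prob_ge_words r (A : seq edge) K n :
  spreads eps r A ->
  #|{: edge}|%:R * n.+1%:R^-1 <= 1 :> R ->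
  (((2 * eps - 1) *
    (1 - (K * size A)%:R * #|{: edge}|%:R ^+ 2 * n.+1%:R^-1
       - (1 - expR (- #|{: edge}|%:R) ^+ size A) ^+ K))%:E
   <= P (consensus eta))%E.
Proof.
move=> HA; set D : R := #|{: edge}|%:R; set h : R := n.+1%:R^-1 => Dh.
have h0 : 0 < h by rewrite invr_gt0.
have nh : n.+1%:R * h = 1 by rewrite mulfV.
pose L := (K * (size A * n.+1))%N.
(* f v is the ancestor of r before an occurrence of A in v, a function of
     the word only. *)
have [f Hf] : {f : seq (option edge) -> V | forall v, infix A (letters v) ->
    exists p s, letters v = p ++ A ++ s /\ f v = ancestor p r}.
  suff /choice[f Hf] : forall v, exists y, infix A (letters v) ->
      exists p s, letters v = p ++ A ++ s /\ y = ancestor p r.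
    by exists f.
  move=> v; have [/infixP[p [s ps]]|] := boolP (infix A (letters v)).
    by exists (ancestor p r) => _; exists p, s.
  by exists r.
pose X v := if infix A (letters v) then [set w | centrist eps (eta 0 (f v) w)] else set0.
have mX v : measurable (X v).
  by rewrite /X; case: ifP => // _; exact: measurable_centrist.
have PX v : P (clock_word N h v `&` X v) = ((\prod_(o <- v) letter_weight h o) *
    ((2 * eps - 1) * (1 - avoids R A v)))%:E.
  rewrite /X /avoids; case: ifP => _ /=.
    by rewrite subr0 mulr1 prob_clock_word_centrist.
  by rewrite setI0 measure0 subrr !mulr0.
pose G := word_event N X h [::] L.
have mG : measurable G by exact: measurable_word_event.
have PG : P G = ((2 * eps - 1) *
    (cell_mass edge h ^+ L - word_sum h L (avoids R A)))%:E.
  rewrite (prob_word_event [::] L h0 mX PX) big_nil mul1r.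
  by rewrite word_sumZ word_sumB word_sum1.
have [B [mB PB0 BC]] := collision_negligible.
have GC : G `<=` consensus eta `|` B.
  move=> w [v [sv /= vw]]; rewrite /X; case: ifPn => // Av cw.
  have [wC|wC] := pselect ((\bigcup_k collision k%:R) w); first by right; exact: BC.
  left; exists ((size v)%:R * h) => t tv.
  apply: (consensus_persists (clocks_counting process w) (dynamics process w) _ tv).
  - by rewrite mulr_ge0// ltW.
  - move=> [a [b [ab [u ut pu]]]]; apply: wC; exists (Num.truncn t).+1 => //.
    exists a, b; split=> //; exists u => //.
    by rewrite (le_trans ut)// ltW// truncnS_gt.
  move=> x y; have etaL z := congr1 (fun f => f z)
    (driven_cell_word (clocks_counting process w) (dynamics process w) (ltW h0) vw).
  rewrite !etaL; move: x y.
  have [p [s [ps fv]]] := Hf v Av.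
  apply: (ancestor_spreading_consensus _ HA ps); last by rewrite -fv.
  by move=> z; have := opinion_state process z w (lexx 0).
have PGC : (P G <= P (consensus eta))%E.
  have mC := measurable_consensus.
  apply: (@le_trans _ _ (P (consensus eta `|` B))).
    by apply: le_measure; rewrite ?inE//; exact: measurableU.
  apply: le_trans (measureU2 _ mC mB) _.
  by rewrite -[leRHS]adde0 leeD2l// le_eqVlt; apply/orP; left; apply/eqP; exact: PB0.
apply: le_trans PGC; rewrite PG lee_fin ler_wpM2l//; first by move: eps_gt => ?; lra.
have := word_sum_avoids (ltW h0) n.+1 K A.
rewrite nh mul1r -expRM_natl mulrN mulrCA nh mulr1 -/D -/L => avoid_le.
have := cell_mass_pow_ge (ltW h0) L Dh.
rewrite exprMn [X in 1 - X](_ : _ = (K * size A)%:R * D ^+ 2 * h) => [mass_ge|].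
  exact: lerB.
have -> : L%:R = (K * size A)%:R * n.+1%:R :> R by rewrite -natrM /L mulnA.
transitivity ((K * size A)%:R * D ^+ 2 * h * (n.+1%:R * h)); first by ring.
by rewrite nh mulr1.
Qed.

(** First choose the number of units of time, so that [A] is spelled with high
    probability, then the mesh, so that cells with two rings are unlikely. *)
Lemma consensus_prob_ge r (A : seq edge) :
  spreads eps r A ->
  ((2 * eps - 1)%:E <= P (consensus eta))%E.
Proof.
move=> HA; set D : R := #|{: edge}|%:R; apply/lee_addgt0Pr => delta d0.
pose q : R := expR (- D) ^+ size A.
have q0 : 0 < q by rewrite exprn_gt0 ?expR_gt0.
have q1 : q <= 1 by rewrite exprn_ile1 ?expR_ge0// -expR0 ler_expR oppr_le0.
have [K HK] : exists K, (1 - q) ^+ K <= delta / 2.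
  have : `|1 - q| < 1 by rewrite ger0_norm ?subr_ge0//; lra.
  move=> /cvg_expr /cvgrPdist_le /(_ (delta / 2)) [|K _ HK]; first lra.
  exists K; have := HK K (leqnn K); rewrite /= sub0r normrN ger0_norm//.
  by rewrite exprn_ge0// subr_ge0.
have [n [Dh cd]] := @fine_mesh R D ((K * size A)%:R * D ^+ 2) (delta / 2)
   (ler0n _ _) (mulr_ge0 (ler0n _ _) (sqr_ge0 _)) ltac:(lra).
have := @consensus_prob_ge_words r A K n HA Dh.
rewrite -/D -/q => /(leeD2r delta%:E); apply: le_trans.
rewrite -EFinD lee_fin.
set a := (K * _)%:R * _ * _ in cd *; set b := (1 - q) ^+ K in HK *.
have : (2 * eps - 1) * (a + b) <= 1 * delta.
  move: eps_gt eps_le1 => ? ?.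
  have [ab|ab] := leP 0 (a + b).
    by apply: ler_pM => //; lra.
  by rewrite mul1r (le_trans _ (ltW d0))// mulr_ge0_le0; lra.
lra.
Qed.

End equilibrium.

Theorem theorem1p6 (d : measure_display) (Omega : measurableType d)
    (R : realType) (P : probability Omega R)
    (V : finType) (e : rel V)
    (e_sym : symmetric e) (e_irr : irreflexive e)
    (V_nonempty : (0 < #|V|)%N) (e_conn : forall x y : V, connect e x y)
    (eps : R) (eps_ge0 : 0 <= eps) (eps_le1 : eps <= 1) (eps_gt : 1 / 2 < eps)
    (N : directed_edge e -> R -> {RV P >-> nat}) (eta : R -> V -> {RV P >-> R})
    (eta_process : is_opinion_process eps N eta) :
  P (consensus eta) = P [set w | nu eta w = 1%N] /\
  ((2 * eps - 1)%:E <= P [set w | nu eta w = 1%N])%E.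
Proof.
rewrite nu_eq1//; split=> //.
have [r _] := card_gt0P V_nonempty.
have [A HA] := @spreading_word R V e eps r (e_conn r).
exact: (consensus_prob_ge eta_process V_nonempty eps_gt eps_le1 HA).
Qed.
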